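(* Let $K$ be an infinite field, $S=K[x_1,\ldots,x_n]$, let $I$ be a monomial ideal of $S$ and let $k$ be a positive integer. If $I$ is strongly stable (respectively Borel-fixed, respectively of Borel type), then the $k$-th symbolic power $I^{(k)}$ is a monomial ideal which is strongly stable (respectively Borel-fixed, respectively of Borel type).
   Context: For a monomial ideal $I$ of $S=K[x_1,\ldots,x_n]$: - $I$ is of Borel type if $I:x_i^{\infty}=I:\langle x_1,\ldots,x_i\rangle^{\infty}$ for every $i=1,\ldots,n$, where $I:L^\infty=\bigcup_{r\ge 1}(I:L^r)$. - $I$ is strongly stable if for every monomial $u\in I$ and all $i<j\le n$ with $x_j\mid u$, one has $x_i(u/x_j)\in I$. - $I$ is Borel-fixed if $\alpha(u)\in I$ for every $u\in I$ and every invertible upper triangular $n\times n$ matrix $\alpha=(\alpha_{ij})$ over $K$, acting on $S$ as the $K$-algebra automorphism $x_j\mapsto\sum_{i\le j}\alpha_{ij}x_i$. $\mathrm{Min}(I)$ denotes the set of prime ideals minimal over $I$. The $k$-th symbolic power of $I$ is $I^{(k)}=\bigcap_{P\in \mathrm{Min}(I)}\ker\big(S\to (S/I^k)_P\big)$. *)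

(* Defs.v *)
From HB Require Import structures.
From mathcomp Require Import all_boot all_order all_algebra.
From mathcomp Require Import mathcomp_extra boolp classical_sets cardinality.
From mathcomp Require Import mpoly.

Set Implicit Arguments.
Unset Strict Implicit.
Unset Printing Implicit Defensive.

Import GRing.Theory.
Local Open Scope classical_set_scope.
Local Open Scope ring_scope.

(* Ideals are sets, and the unit ideal is allowed; [idealr_closed] of
   ring_quotient requires ideals to be proper. *)
Definition is_ideal (R : comNzRingType) (I : set R) : Prop :=
  [/\ I 0,
      forall u v, I u -> I v -> I (u + v) &
      forall a u, I u -> I (a * u)].

Definition ideal_span (R : comNzRingType) (A : set R) : set R :=
  smallest (@is_ideal R) A.

Definition is_prime_ideal (R : comNzRingType) (P : set R) : Prop :=
  [/\ is_ideal P, ~ P 1 & forall a b, P (a * b) -> P a \/ P b].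

Definition Min (R : comNzRingType) (I : set R) : set (set R) :=
  [set P | [/\ is_prime_ideal P, I `<=` P &
     forall Q, is_prime_ideal Q -> I `<=` Q -> Q `<=` P -> Q = P]].

Definition ideal_pow (R : comNzRingType) (I : set R) (k : nat) : set R :=
  ideal_span [set x | exists2 f : 'I_k -> R,
    (forall i, I (f i)) & x = \prod_(i < k) f i].

Definition colon (R : comNzRingType) (I L : set R) : set R :=
  [set f | forall g, L g -> I (f * g)].

Definition colon_inf (R : comNzRingType) (I L : set R) : set R :=
  \bigcup_(r in [set r : nat | (1 <= r)%N]) colon I (ideal_pow L r).

(* Equality of the fractions a/s and b/t in the localization (R/J)_P, for s
   and t outside P; the numerators a and b stand for their classes modulo J. *)
Definition loc_eq (R : comNzRingType) (J P : set R) (x y : R * R) : Prop :=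
  exists2 u, ~ P u & J (u * (y.2 * x.1 - x.2 * y.1)).

(* ker (R -> (R/J)_P) *)
Definition loc_ker (R : comNzRingType) (J P : set R) : set R :=
  [set f | loc_eq J P (f, 1) (0, 1)].

Definition symbolic_power (R : comNzRingType) (I : set R) (k : nat) : set R :=
  \bigcap_(P in Min I) loc_ker (ideal_pow I k) P.

Definition is_monomial_ideal (n : nat) (K : fieldType)
    (I : set {mpoly K[n]}) : Prop :=
  exists G : set 'X_{1..n}, I = ideal_span [set 'X_[K, m] | m in G].

Definition borel_type (n : nat) (K : fieldType)
    (I : set {mpoly K[n]}) : Prop :=
  forall i : 'I_n,
    colon_inf I (ideal_span [set 'X_i]) =
    colon_inf I (ideal_span [set 'X_j | j in [set j : 'I_n | (j <= i)%N]]).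

Definition strongly_stable (n : nat) (K : fieldType)
    (I : set {mpoly K[n]}) : Prop :=
  forall (m : 'X_{1..n}) (i j : 'I_n),
    I 'X_[m] -> (i < j)%N -> (0 < m j)%N -> I ('X_i * 'X_[m - U_(j)]).

(* The substitution x_j |-> \sum_(i <= j) alpha_ij x_i *)
Definition upper_act (n : nat) (K : fieldType) (alpha : 'M[K]_n)
    (f : {mpoly K[n]}) : {mpoly K[n]} :=
  comp_mpoly [tuple \sum_(i < n | (i <= j)%N) alpha i j *: 'X_i | j < n] f.

(* [is_trig_mx] means lower triangular, hence the transpose. *)
Definition borel_fixed (n : nat) (K : fieldType)
    (I : set {mpoly K[n]}) : Prop :=
  forall (alpha : 'M[K]_n) (u : {mpoly K[n]}),
    alpha \in unitmx -> is_trig_mx alpha^T -> I u -> I (upper_act alpha u).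

(* Main.v *)
(* A ring automorphism that maps [I] onto itself permutes the minimal primes of
   [I], hence preserves every symbolic power.  Applied to the torus this makes
   [I^(k)] a monomial ideal, as [K] is infinite; applied to the upper triangular
   group it makes [I^(k)] Borel-fixed when [I] is.
   If [I] is strongly stable then so is [I^k], and a monomial [m] lies in the
   kernel at [P] iff [w m] is in [I^k] for some monomial [w] outside [P]; the
   exchange of variables is then done in [w m], inside [m].
   [I] is of Borel type iff [f x_i^r] in [I] implies [f x_j^s] in [I] for some
   [s], whenever [j <= i].  Let [P] be a minimal prime of [I].  If [x_j] is in
   [P], then a power of [x_j] lies in [I] up to a factor outside [P], so [f] is
   irrelevant; otherwise [x_i] is also outside [P] and [x_i^r] can be absorbed
   into the factor outside [P]. *)
Require Import Defs.
From HB Require Import structures.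
From mathcomp Require Import all_boot all_order all_algebra.
From mathcomp Require Import mathcomp_extra boolp classical_sets cardinality.
From mathcomp Require Import mpoly.

Set Implicit Arguments.
Unset Strict Implicit.
Unset Printing Implicit Defensive.

Import GRing.Theory.
Local Open Scope classical_set_scope.
Local Open Scope ring_scope.

(** * Ideals and their powers *)

Lemma ideal_span_ideal (R : comNzRingType) (A : set R) :
  is_ideal (ideal_span A).
Proof.
split=> [J [[]]|u v hu hv J hJ|a u hu J hJ] //.
- by case: (hJ) => -[_ hD _] _; apply: hD; [apply: hu | apply: hv].
- by case: (hJ) => -[_ _ hM] _; apply: hM; apply: hu.
Qed.

Lemma ideal_sum (R : comNzRingType) (P : set R) (T : Type) (r : seq T)
    (p : pred T) (f : T -> R) :
  is_ideal P -> (forall i, p i -> P (f i)) -> P (\sum_(i <- r | p i) f i).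
Proof. by case=> h0 hD _ hf; apply: big_ind. Qed.

Lemma ideal_pow_ideal (R : comNzRingType) (I : set R) k :
  is_ideal (ideal_pow I k).
Proof. exact: ideal_span_ideal. Qed.

Lemma ideal_pow_prod (R : comNzRingType) (I : set R) k (f : 'I_k -> R) :
  (forall i, I (f i)) -> ideal_pow I k (\prod_i f i).
Proof. by move=> hf J [_]; apply; exists f. Qed.

Lemma ideal_pow_exp (R : comNzRingType) (I : set R) k x :
  I x -> ideal_pow I k (x ^+ k).
Proof.
move=> hx; have := @ideal_pow_prod _ I k (fun=> x) (fun=> hx).
by rewrite prodr_const card_ord.
Qed.

Lemma ideal_pow_sub (R : comNzRingType) (I J : set R) k :
  is_ideal J ->
  (forall f : 'I_k -> R, (forall i, I (f i)) -> J (\prod_i f i)) ->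
  ideal_pow I k `<=` J.
Proof. by move=> hJ h; apply: smallest_sub => // x [f hf ->]; apply: h. Qed.

(** * Prime ideals and minimal primes *)

Lemma prime_idealX (R : comNzRingType) (P : set R) x r :
  is_prime_ideal P -> P (x ^+ r) -> P x.
Proof.
case=> hP h1 hM; elim: r => [//|r IH]; rewrite exprS => /hM[//|].
exact: IH.
Qed.

Lemma prime_idealNM (R : comNzRingType) (P : set R) x y :
  is_prime_ideal P -> ~ P x -> ~ P y -> ~ P (x * y).
Proof. by case=> _ _ hM hx hy /hM[]. Qed.

Lemma preim_ideal (R : comNzRingType) (f : {rmorphism R -> R}) (P : set R) :
  is_ideal P -> is_ideal (f @^-1` P).
Proof.
case=> h0 hD hM; split=> [|u v|a u] /=; first by rewrite rmorph0.
  by rewrite rmorphD; apply: hD.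
by rewrite rmorphM; apply: hM.
Qed.

Lemma preim_prime_ideal (R : comNzRingType) (f : {rmorphism R -> R})
    (P : set R) :
  is_prime_ideal P -> is_prime_ideal (f @^-1` P).
Proof.
case=> hP h1 hM; split=> [||a b] /=; first exact: preim_ideal.
  by rewrite rmorph1.
by rewrite rmorphM; apply: hM.
Qed.

(** Zorn's lemma gives an ideal maximal among those that contain [I] and miss the multiplicative set
    [S]; maximality forces it to be prime. *)
Lemma exists_prime_avoiding (R : comNzRingType) (I S : set R) :
  is_ideal I -> S 1 -> (forall a b, S a -> S b -> S (a * b)) ->
  (forall x, I x -> ~ S x) ->
  exists Q, [/\ is_prime_ideal Q, I `<=` Q & forall x, Q x -> ~ S x].
Proof.
move=> [I0 ID IM] S1 SM IS.
(* The union with [I] makes the empty chain harmless. *)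
pose ok (A : set R) := is_ideal (A `|` I) /\ (forall x, A x -> ~ S x).
have [|A [[Aid AS] Amax]] := @Zorn_bigcup R ok.
  move=> F Fok Ftot; split; last by move=> x [X /Fok[_ h]]; apply: h.
  split=> [|u v|a u]; first by right.
  - move=> [[X FX Xu]|Iu] [[Y FY Yv]|Iv].
    + have [Z [FZ Zu Zv]] : exists Z, [/\ F Z, Z u & Z v].
        by have [h|h] := Ftot X Y FX FY; [exists Y|exists X]; split=> //;
          apply: h.
      have [[_ ZD _] _] := Fok Z FZ.
      by have [] := ZD u v; [left|left|left; exists Z|right].
    + have [[_ XD _] _] := Fok X FX.
      by have [] := XD u v; [left|right|left; exists X|right].
    + have [[_ XD _] _] := Fok Y FY.
      by have [] := XD u v; [right|left|left; exists Y|right].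
    + by right; apply: ID.
  - move=> [[X FX Xu]|Iu]; last by right; apply: IM.
    have [[_ _ XM] _] := Fok X FX.
    by have [] := XM a u; [left|left; exists X|right].
set Q := A `|` I in Aid.
have QS x : Q x -> ~ S x by move=> []; [apply: AS|apply: IS].
have IQ : I `<=` Q by move=> x; right.
have [Q0 Qadd QM] := Aid.
(* Otherwise the ideal generated by [Q] and [a] would miss [S], against the maximality of [A]. *)
have Qmax a : ~ Q a -> exists q r, Q q /\ S (q + r * a).
  move=> Qa; apply: contrapT => h.
  pose B := [set x | exists q r, Q q /\ x = q + r * a].
  have QB : Q `<=` B by move=> q Qq; exists q, 0; rewrite mul0r addr0.
  apply: (Amax B); first split.
  - by move=> x Ax; apply: QB; left.
  - move=> /(_ a) hBA; apply: Qa; left; apply: hBA.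
    by exists 0, 1; rewrite add0r mul1r.
  - split; last by move=> x [q [r [Qq ->]]] hS; apply: h; exists q, r.
    have -> : B `|` I = B by apply/setUidPl => x /IQ /QB.
    split; first exact: QB.
      move=> _ _ [q [r [Qq ->]]] [q' [r' [Qq' ->]]].
      by exists (q + q'), (r + r'); split; [apply: Qadd|rewrite mulrDl addrACA].
    move=> c _ [q [r [Qq ->]]].
    by exists (c * q), (c * r); split; [apply: QM|rewrite mulrDr mulrA].
exists Q; split=> //; split=> // [|a b Qab]; first by move=> /QS.
apply: contrapT => /not_orP[/Qmax[q [r [Qq h]]] /Qmax[q' [r' [Qq' h']]]].
(* Since [a * b] is in [Q], so is the product of these two elements of [S]. *)
apply: (QS _ _ (SM _ _ h h')).
rewrite mulrDl [r * a * _]mulrDr; apply: (Qadd).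
  by rewrite mulrC; apply: QM.
by apply: Qadd; [apply: QM|rewrite mulrACA; apply: QM].
Qed.

(** After localizing at [P], the only prime over [I] is [P] itself, so its elements are nilpotent
    modulo [I]. Concretely, if the products of powers of [x] with elements outside [P] all missed
    [I], a prime over [I] missing them would lie strictly inside [P]. *)
Lemma Min_nilpotent (R : comNzRingType) (I P : set R) x :
  is_ideal I -> Min I P -> P x ->
  exists u r, ~ P u /\ I (u * x ^+ r).
Proof.
move=> hI [hP IP Pmin] Px; apply: contrapT => hno.
pose S := [set y | exists u r, ~ P u /\ y = u * x ^+ r].
have [_ P1 PM] := hP.
have [||y Iy [u [r [Pu e]]]|Q [Qp IQ QS]] := @exists_prime_avoiding R I S hI.
- by exists 1, 0%N; rewrite mulr1.
- move=> _ _ [u [r [Pu ->]]] [v [s [Pv ->]]].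
  exists (u * v), (r + s)%N; rewrite exprD mulrACA.
  by split=> // /PM[].
- by apply: hno; exists u, r; rewrite -e.
have QP : Q = P.
  apply: Pmin => // y Qy; apply: contrapT => Py.
  by apply: (QS y Qy); exists y, 0%N; rewrite mulr1.
apply: (QS x); first by rewrite QP.
by exists 1, 1%N; rewrite mul1r.
Qed.

(** * Symbolic powers and ring automorphisms *)

Lemma loc_kerE (R : comNzRingType) (J P : set R) f :
  loc_ker J P f <-> exists2 u, ~ P u & J (u * f).
Proof.
by rewrite /loc_ker /loc_eq /=; split=> -[u Pu h]; exists u => //;
  move: h; rewrite mul1r mulr0 subr0.
Qed.

Lemma symbolic_power_ideal (R : comNzRingType) (I : set R) k :
  is_ideal (symbolic_power I k).
Proof.
have [J0 JD JM] := ideal_pow_ideal I k.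
split=> [P hP|f g hf hg P hP|a f hf P hP].
- apply/loc_kerE; exists 1; last by rewrite mulr0.
  by case: hP => -[].
- have /loc_kerE[u Pu hu] := hf P hP; have /loc_kerE[v Pv hv] := hg P hP.
  case: hP => Pp _ _.
  apply/loc_kerE; exists (u * v); first exact: prime_idealNM.
  rewrite mulrDr; apply: JD; last by rewrite -mulrA; apply: JM.
  by rewrite [u * v]mulrC -mulrA; apply: JM.
- have /loc_kerE[u Pu hu] := hf P hP.
  by apply/loc_kerE; exists u => //; rewrite mulrCA; apply: JM.
Qed.

Lemma symbolic_power_rmorph (R : comNzRingType) (I : set R) k
    (f g : {rmorphism R -> R}) :
  cancel f g -> cancel g f ->
  (forall u, I u -> I (f u)) -> (forall u, I u -> I (g u)) ->
  forall x, symbolic_power I k x -> symbolic_power I k (f x).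
Proof.
move=> fK gK If Ig x hx P [Pp IP Pmin].
have hQ : Min I (f @^-1` P).
  split=> [|u /If /IP //|Q Qp IQ QP]; first exact: preim_prime_ideal.
  (* Pulling [Q] back along [g] gives a prime below [P], where minimality applies. *)
  suff <- : g @^-1` Q = P by apply/seteqP; split=> u /=; rewrite fK.
  apply: Pmin; [exact: preim_prime_ideal|by move=> u /Ig /IQ|].
  by move=> u /QP /=; rewrite gK.
have /loc_kerE[u Pu hu] := hx _ hQ.
apply/loc_kerE; exists (f u) => //; rewrite -rmorphM.
have : (ideal_pow I k) `<=` f @^-1` (ideal_pow I k).
  apply: ideal_pow_sub; first exact/preim_ideal/ideal_pow_ideal.
  by move=> h hh /=; rewrite rmorph_prod; apply: ideal_pow_prod => i; apply: If.
exact.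
Qed.

(** * Monomial ideals *)

(** Reduces a claim on the monomials of all elements of an ideal span to the generators. *)
Lemma supp_ideal (K : fieldType) n (J : set {mpoly K[n]}) :
  is_ideal J ->
  is_ideal [set f : {mpoly K[n]} | forall m, m \in msupp f -> J 'X_[m]].
Proof.
case=> J0 JD JM; split=> [m|f g hf hg m|f g hg m] /=.
- by rewrite msupp0.
- by move/msuppD_le; rewrite mem_cat => /orP[/hf|/hg].
- move/msuppM_le/allpairsP => -[[m1 m2] /= [_ /hg h ->]].
  by rewrite mpolyXD; apply: JM.
Qed.

Lemma ideal_msupp (K : fieldType) n (J : set {mpoly K[n]}) f :
  is_ideal J -> (forall m, m \in msupp f -> J 'X_[m]) -> J f.
Proof.
move=> hJ hf; have [_ _ JM] := hJ.
rewrite [f]mpolyE big_seq; apply: ideal_sum => // m /hf.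
by rewrite -mul_mpolyC; apply: JM.
Qed.

Lemma monomial_idealP (K : fieldType) n (J : set {mpoly K[n]}) :
  is_monomial_ideal J <->
  is_ideal J /\ forall f m, J f -> m \in msupp f -> J 'X_[m].
Proof.
split=> [[G ->]|[hJ hm]].
  split=> [|f m hf]; first exact: ideal_span_ideal.
  suff : ideal_span [set 'X_[K, m] | m in G] `<=`
    [set f | forall m, m \in msupp f ->
       ideal_span [set 'X_[K, m] | m in G] 'X_[m]] by move=> /(_ _ hf); apply.
  apply: smallest_sub; first exact/supp_ideal/ideal_span_ideal.
  move=> _ [g Gg <-] m' /mem_msuppXP <- C [_]; apply.
  by exists g.
exists [set m | J 'X_[m]]; apply/seteqP; split=> [f Jf|].
  apply: ideal_msupp; first exact: ideal_span_ideal.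
  by move=> m /(hm _ _ Jf) h C [_]; apply; exists m.
by apply: smallest_sub => // _ [m h <-].
Qed.

Lemma msupp_prod (K : fieldType) n k (f : 'I_k -> {mpoly K[n]}) m :
  m \in msupp (\prod_i f i) ->
  exists2 h : 'I_k -> 'X_{1..n},
    forall i, h i \in msupp (f i) & m = (\sum_i h i)%MM.
Proof.
elim: k f m => [|k IH] f m.
  rewrite big_ord0 msupp1 inE => /eqP ->.
  by exists (fun=> 0%MM) => [[]//|]; rewrite big_ord0.
rewrite big_ord_recl => /msuppM_le/allpairsP[[m1 m2] /= [h1 /IH[h hh ->] ->]].
exists (fun i => if unlift ord0 i is Some j then h j else m1) => [i|].
  by case: unliftP => [j|] ->.
rewrite big_ord_recl unlift_none; congr (_ + _)%MM.
by apply: eq_bigr => i _; rewrite liftK.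
Qed.

(** The polynomials on the right form an ideal, and a monomial of a product of [k] elements of [I]
    is a product of monomials of the factors, each in [I] as [I] is monomial. *)
Lemma ideal_powP (K : fieldType) n (I : set {mpoly K[n]}) k f :
  is_monomial_ideal I ->
  ideal_pow I k f <->
  forall m, m \in msupp f -> exists2 h : 'I_k -> 'X_{1..n},
    forall i, I 'X_[h i] & (\sum_i h i <= m)%MM.
Proof.
move=> /monomial_idealP[hI hm]; split=> [|hf].
  move: f; apply: ideal_pow_sub; first split=> [m|f g hf hg m|f g hg m] /=.
  - by rewrite msupp0.
  - by move/msuppD_le; rewrite mem_cat => /orP[/hf|/hg].
  - move/msuppM_le/allpairsP => -[[m1 m2] /= [_ /hg[h hh le_hm] ->]].
    by exists h => //; apply: lepm_trans le_hm (lem_addl _ _).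
  - move=> f hf m /= /msupp_prod[h hh ->]; exists h; last exact: lepm_refl.
    by move=> i; apply: hm (hf i) (hh i).
apply: ideal_msupp; first exact: ideal_pow_ideal.
move=> m /hf[h hh le_hm].
rewrite -(submK le_hm) mpolyXD -mprodXE.
by case: (ideal_pow_ideal I k) => _ _; apply; apply: ideal_pow_prod.
Qed.

Lemma ideal_pow_monomial (K : fieldType) n (I : set {mpoly K[n]}) k :
  is_monomial_ideal I -> is_monomial_ideal (ideal_pow I k).
Proof.
move=> hI; apply/monomial_idealP; split; first exact: ideal_pow_ideal.
move=> f m /(ideal_powP _ _ hI) hf /hf h.
by apply/(ideal_powP _ _ hI) => m' /mem_msuppXP <-.
Qed.

Lemma exists_msupp_notin (K : fieldType) n (P : set {mpoly K[n]}) u :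
  is_ideal P -> ~ P u -> exists2 m, m \in msupp u & ~ P 'X_[m].
Proof.
move=> hP Pu; apply: contrapT => h; apply: Pu; apply: ideal_msupp hP _ => m hm.
by apply: contrapT => Pm; apply: h; exists m.
Qed.

(** Some monomial of [u] is outside [P]; multiplying by a single monomial causes no cancellation, so
    its multiple occurs in the product. *)
Lemma monomial_multiplier (K : fieldType) n (J P : set {mpoly K[n]}) u m :
  is_monomial_ideal J -> is_ideal P -> ~ P u -> J (u * 'X_[m]) ->
  exists2 w, ~ P 'X_[w] & J 'X_[w + m].
Proof.
move=> /monomial_idealP[_ hm] hP /(exists_msupp_notin hP)[w wu Pw] hJ.
exists w => //; apply: hm hJ _.
by rewrite (perm_mem (msuppMX _ _)) addmC; apply: map_f.
Qed.

(** * Strongly stable ideals *)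

(** If ['X_j] divides one of the [k] factors, the exchange is made in that factor. Otherwise ['X_j]
    comes from the cofactor, and the same factors still divide the new monomial. *)
Lemma strongly_stable_ideal_pow (K : fieldType) n (I : set {mpoly K[n]}) k :
  is_monomial_ideal I -> strongly_stable I -> strongly_stable (ideal_pow I k).
Proof.
move=> hI hS m i j /(ideal_powP _ _ hI) /(_ m).
rewrite msuppX mem_head => /(_ isT)[h hh /mnm_lepP le_hm] ij mj.
rewrite -mpolyXD; apply/(ideal_powP _ _ hI) => _ /mem_msuppXP <-.
have nij : (i == j) = false by rewrite -val_eqE ltn_eqF.
have [[l hl]|hno] := EM (exists l, (0 < h l j)%N); last first.
  exists h => //; apply/mnm_lepP => a; have := le_hm a.
  rewrite !mnmE !mnm_sumE; case: (eqVneq j a) => [<-|] /=; last first.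
    by rewrite subn0 => _ /leq_trans; apply; apply: leq_addl.
  rewrite big1 // => l _; apply/eqP; rewrite -leqn0 leqNgt.
  by apply/negP => hl; apply: hno; exists l.
pose h' l' := if l' == l then (U_(i) + (h l - U_(j)))%MM else h l'.
exists h' => [l'|].
  by rewrite /h'; case: eqP => // _; rewrite mpolyXD; apply: hS.
apply/mnm_lepP => a; have := le_hm a.
rewrite !mnmE !mnm_sumE (bigD1 l) //= [X in (_ -> X <= _)%N](bigD1 l) //=.
rewrite /h' eqxx.
under [X in (_ -> _ + X <= _)%N]eq_bigr => l' /negbTE -> do [].
rewrite !mnmE -addnA leq_add2l; case: (eqVneq j a) => [<-|] /=.
  by move=> le; rewrite addnBAC // leq_sub2r.
by rewrite !subn0.
Qed.

Lemma strongly_stable_symbolic_power (K : fieldType) n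
    (I : set {mpoly K[n]}) k :
  is_monomial_ideal I -> strongly_stable I ->
  strongly_stable (symbolic_power I k).
Proof.
move=> hI hS m i j hm ij mj P hP.
have Pp : is_prime_ideal P by case: hP.
have /loc_kerE[u Pu hu] := hm P hP.
have [|w Pw hw] := monomial_multiplier (ideal_pow_monomial k hI) _ Pu hu.
  by case: Pp.
apply/loc_kerE; exists 'X_[w] => //.
have /(_ k)/(_ _ i j hw ij) := strongly_stable_ideal_pow hI hS.
rewrite mnmDE addn_gt0 mj orbT => /(_ isT).
rewrite -!mpolyXD addmA; congr (ideal_pow _ _ 'X_[_]).
apply/mnmP => a; rewrite !mnmE; case: (eqVneq j a) => [<-|] /=; last first.
  by rewrite !subn0 addnCA addnA.
(* Subtraction is truncated: shifting it from [w + m] to [m] uses [mj]. *)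
by rewrite -addnBA // addnCA addnA.
Qed.

(** * Upper triangular substitutions and Borel-fixed ideals *)

(** Strong induction on the row: in the entry [i j] of [A *m invmx A], with [i < j], only the term
    with [A i i] survives, and [A i i] is nonzero. *)
Lemma trig_invmx (K : fieldType) n (A : 'M[K]_n) :
  A \in unitmx -> is_trig_mx A -> is_trig_mx (invmx A).
Proof.
move=> Au At; apply/is_trig_mxP => i; have [d] := ubnP (val i).
elim: d i => // d IH i le_id j ij.
have Aii : A i i != 0.
  move: Au; rewrite unitmxE unitfE (det_trig At).
  by apply: contraNneq => Ai0; rewrite (bigD1 i) //= Ai0 mul0r.
apply: (mulfI Aii); rewrite mulr0.
have /matrixP/(_ i j) := mulmxV Au; rewrite !mxE -val_eqE (ltn_eqF ij).
rewrite (bigD1 i) //= big1 ?addr0 // => l nli.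
have [li|il|/val_inj e] := ltngtP l i; last by rewrite e eqxx in nli.
  by rewrite IH ?mulr0 //; [apply: leq_trans li _|apply: ltn_trans ij].
by rewrite (is_trig_mxP At) ?mul0r.
Qed.

Definition upper_forms (K : fieldType) n (A : 'M[K]_n) :=
  [tuple \sum_(i < n | (i <= j)%N) A i j *: ('X_i : {mpoly K[n]}) | j < n].

(** The unrestricted sum lets substitutions compose by matrix multiplication. *)
Lemma tnth_upper_forms (K : fieldType) n (A : 'M[K]_n) j :
  is_trig_mx A^T -> tnth (upper_forms A) j = \sum_i A i j *: 'X_i.
Proof.
move=> At; rewrite tnth_mktuple [RHS](bigID (fun i : 'I_n => (i <= j)%N)) /=.
rewrite [X in _ + X]big1 ?addr0 // => i; rewrite -ltnNge => ji.
by have := is_trig_mxP At _ _ ji; rewrite mxE => ->; rewrite scale0r.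
Qed.

Lemma upper_actX (K : fieldType) n (A : 'M[K]_n) m :
  upper_act A 'X_[m] = \prod_i tnth (upper_forms A) i ^+ m i.
Proof. exact: comp_mpolyX. Qed.

(** It suffices to look at the variables, on which the composite acts through the columns of
    [A *m B]. *)
Lemma upper_actK (K : fieldType) n (A B : 'M[K]_n) :
  is_trig_mx A^T -> is_trig_mx B^T -> A *m B = 1%:M ->
  cancel (upper_act B) (upper_act A).
Proof.
move=> At Bt AB f.
rewrite /upper_act [f \mPo _]comp_mpolyE raddf_sum [RHS]mpolyE /=.
apply: eq_bigr => m _; rewrite comp_mpolyZ; congr (_ *: _).
rewrite rmorph_prod [RHS]mpolyXE_id; apply: eq_bigr => j _.
rewrite rmorphXn /=; congr (_ ^+ _).
rewrite (tnth_upper_forms j Bt) rmorph_sum /=.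
under eq_bigr => i _ do
  rewrite comp_mpolyZ /comp_mpoly mmapX mmap1U (tnth_upper_forms i At)
    scaler_sumr.
have coef l : \sum_i B i j *: (A l i *: 'X_l) =
    (l == j)%:R *: 'X_l :> {mpoly K[n]}.
  under eq_bigr => i _ do rewrite scalerA mulrC.
  by rewrite -scaler_suml; have /matrixP/(_ l j) := AB; rewrite !mxE => ->.
rewrite exchange_big /= (eq_bigr _ (fun l _ => coef l)) (bigD1 j) //= eqxx.
by rewrite scale1r big1 ?addr0 // => l /negbTE ->; rewrite scale0r.
Qed.

Lemma symbolic_power_upper_act (K : fieldType) n (I : set {mpoly K[n]}) k
    (A B : 'M[K]_n) :
  is_trig_mx A^T -> is_trig_mx B^T -> A *m B = 1%:M ->
  (forall u, I u -> I (upper_act A u)) ->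
  (forall u, I u -> I (upper_act B u)) ->
  forall f, symbolic_power I k f -> symbolic_power I k (upper_act A f).
Proof.
move=> At Bt AB IA IB.
have /(upper_actK Bt At) BK := mulmx1C AB.
exact: (@symbolic_power_rmorph _ I k (comp_mpoly (upper_forms A))
  (comp_mpoly (upper_forms B)) BK (upper_actK At Bt AB) IA IB).
Qed.

Lemma borel_fixed_symbolic_power (K : fieldType) n (I : set {mpoly K[n]}) k :
  borel_fixed I -> borel_fixed (symbolic_power I k).
Proof.
move=> hI A f Au At.
have Bt : is_trig_mx (invmx A)^T.
  by rewrite trmx_inv; apply: trig_invmx; rewrite ?unitmx_tr.
apply: (symbolic_power_upper_act At Bt (mulmxV Au)) => u.
  exact: hI.
by apply: hI; rewrite ?unitmx_inv.
Qed.

(** * The torus action and monomiality of symbolic powers *)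

(** The torus enters one coordinate at a time, as diagonal matrices, so that the results on
    triangular substitutions apply. *)
Definition scale_var (K : fieldType) n (i : 'I_n) (t : K) : 'M[K]_n :=
  diag_mx (\row_j (if j == i then t else 1)).

Lemma scale_var_trig (K : fieldType) n (i : 'I_n) (t : K) :
  is_trig_mx (scale_var i t)^T.
Proof. by rewrite tr_diag_mx diag_mx_is_trig. Qed.

Lemma scale_varV (K : fieldType) n (i : 'I_n) (t : K) :
  t != 0 -> scale_var i t *m scale_var i t^-1 = 1%:M.
Proof.
move=> t0; rewrite mulmx_diag -diag_const_mx; congr diag_mx.
by apply/rowP => j; rewrite !mxE; case: eqP; rewrite ?mulr1 ?mulfV.
Qed.

Lemma scale_var_actX (K : fieldType) n (i : 'I_n) (t : K) m :
  upper_act (scale_var i t) 'X_[m] = t ^+ m i *: 'X_[m].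
Proof.
rewrite upper_actX [in RHS]mpolyXE_id.
have forms j : tnth (upper_forms (scale_var i t)) j =
    (if j == i then t else 1) *: 'X_j.
  rewrite tnth_upper_forms ?scale_var_trig // (bigD1 j) //= big1 ?addr0.
    by rewrite !mxE eqxx mulr1n.
  by move=> l nlj; rewrite !mxE (negbTE nlj) mulr0n scale0r.
under eq_bigr => j _ do rewrite forms exprZn.
rewrite scaler_prod; congr (_ *: _).
rewrite (bigD1 i) //= eqxx big1 ?mulr1 // => j /negbTE ->.
by rewrite expr1n.
Qed.

Lemma mcoeff_scale_var (K : fieldType) n (i : 'I_n) (t : K) f m :
  (upper_act (scale_var i t) f)@_m = t ^+ m i * f@_m.
Proof.
rewrite /upper_act comp_mpolyEX.
under eq_bigr => m' _ do rewrite -/(upper_act _ _) scale_var_actX.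
rewrite [in RHS](mpolyE f) !raddf_sum mulr_sumr /=; apply: eq_bigr => m' _.
rewrite !mcoeffZ mcoeffX; case: eqP => [->|_]; last by rewrite !mulr0.
by rewrite mulrCA mulr1 mulrC.
Qed.

Lemma separating_scalar (K : fieldType) a b :
  infinite_set [set: K] -> a != b -> exists2 t : K, t != 0 & t ^+ a != t ^+ b.
Proof.
(* The exponents are raised by one so that 0 is a root too: without a separating [t], every element
   of [K] would be a root of [p]. *)
move=> hK nab; pose p : {poly K} := 'X^(a.+1) - 'X^(b.+1).
have p0 : p != 0.
  rewrite subr_eq0; apply: contra_neq nab.
  by move=> /(congr1 (fun q : {poly K} => size q)); rewrite !size_polyXn => -[].
apply: contrapT => hno; have [C _ leC] := infinite_set_fset (size p) hK.
suff roots : all (root p) (finmap.enum_fset C).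
  by have := max_poly_roots p0 roots (finmap.fset_uniq C); rewrite ltnNge leC.
apply/allP => t _; rewrite rootE !hornerE.
have [->|t0] := eqVneq t 0; first by rewrite !expr0n subrr.
rewrite !exprS -mulrBr mulf_eq0 (negbTE t0) subr_eq0 /=.
by apply/negPn/negP => h; apply: hno; exists t.
Qed.

(* Subtracting [t ^+ m0 i] times an element from its torus translate kills
   [m0] but keeps a monomial with another exponent of ['X_i]. *)
Lemma torus_invariant_monomial (K : fieldType) n (J : set {mpoly K[n]}) :
  infinite_set [set: K] -> is_ideal J ->
  (forall i t, t != 0 -> forall f, J f -> J (upper_act (scale_var i t) f)) ->
  is_monomial_ideal J.
Proof.
move=> hK hJ hT; have [J0 JD JM] := hJ.
have JZ c f : J f -> J (c *: f) by rewrite -mul_mpolyC; apply: JM.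
apply/monomial_idealP; split=> // f m.
have [d] := ubnP (size (msupp f)); elim: d f m => // d IH f m le_d Jf mf.
have [[m' nm m'f]|hno] := EM (exists2 m', m' != m & m' \in msupp f); last first.
  have -> : 'X_[m] = (f@_m)^-1 *: f.
    apply/mpolyP => m'; rewrite mcoeffZ mcoeffX.
    case: (eqVneq m m') => [<-|nm]; first by rewrite mulVf // -mcoeff_msupp.
    have m'f : m' \notin msupp f.
      by apply/negP => m'f; apply: hno; exists m'; rewrite 1?eq_sym.
    by rewrite (memN_msupp_eq0 m'f) mulr0.
  exact: JZ.
have step g m0 : J g -> {subset msupp g <= msupp f} -> m0 \in msupp f ->
    g@_m0 = 0 -> forall m1, m1 \in msupp g -> J 'X_[m1].
  move=> Jg gf m0f gm0 m1 m1g; apply: IH Jg m1g.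
  rewrite -ltnS; apply: leq_trans le_d; rewrite ltnS.
  have : (size (m0 :: msupp g) <= size (msupp f))%N.
    apply: uniq_leq_size => [|x]; rewrite /= ?msupp_uniq ?andbT.
      by rewrite mcoeff_msupp gm0 eqxx.
    by rewrite inE => /orP[/eqP->|/gf].
  by [].
(* The other monomial comes first: the torus difference removes [m] and keeps [m']. Once ['X_[m']]
   is in [J], its term can be subtracted from [f], which keeps [m]. *)
have Jm' : J 'X_[m'].
  have [i nmi] : exists i, m' i != m i.
    apply: contrapT => h; move/eqP: nm; apply; apply/mnmP => i.
    by apply/eqP; apply: contrapT => /negP hi; apply: h; exists i.
  have [t t0 ht] := separating_scalar hK nmi.
  pose g := upper_act (scale_var i t) f - t ^+ m i *: f.
  have gE x : g@_x = (t ^+ x i - t ^+ m i) * f@_x.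
    by rewrite mcoeffB mcoeffZ mcoeff_scale_var mulrBl.
  apply: (step g m) => //.
  - by rewrite /g -scaleNr; apply: JD; [apply: hT|apply: JZ].
  - by move=> x; rewrite !mcoeff_msupp gE mulf_eq0 negb_or => /andP[].
  - by rewrite gE subrr mul0r.
  - rewrite mcoeff_msupp gE mulf_neq0 ?subr_eq0 //.
    by rewrite -mcoeff_msupp.
pose g := f - f@_m' *: 'X_[m'].
have gE x : g@_x = f@_x - f@_m' * (m' == x)%:R.
  by rewrite mcoeffB mcoeffZ mcoeffX.
apply: (step g m') => //.
- by rewrite /g -scaleNr; apply: JD => //; apply: JZ.
- move=> x; rewrite !mcoeff_msupp gE; case: (eqVneq m' x) => [<-|_].
    by rewrite mulr1 subrr eqxx.
  by rewrite mulr0 subr0.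
- by rewrite gE eqxx mulr1 subrr.
- by rewrite mcoeff_msupp gE (negbTE nm) mulr0 subr0 -mcoeff_msupp.
Qed.

Lemma monomial_scale_var (K : fieldType) n (I : set {mpoly K[n]}) i t f :
  is_monomial_ideal I -> I f -> I (upper_act (scale_var i t) f).
Proof.
move=> /monomial_idealP[hI hm] If; have [_ _ IM] := hI.
rewrite /upper_act comp_mpolyEX big_seq; apply: ideal_sum => // m mf.
rewrite -/(upper_act _ _) scale_var_actX scalerA -mul_mpolyC.
by apply: IM; apply: hm If mf.
Qed.

Lemma symbolic_power_monomial (K : fieldType) n (I : set {mpoly K[n]}) k :
  infinite_set [set: K] -> is_monomial_ideal I ->
  is_monomial_ideal (symbolic_power I k).
Proof.
move=> hK hI.
apply: (torus_invariant_monomial hK (symbolic_power_ideal I k)).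
move=> i t t0; apply: (symbolic_power_upper_act (B := scale_var i t^-1)).
- exact: scale_var_trig.
- exact: scale_var_trig.
- exact: scale_varV.
- by move=> u; apply: monomial_scale_var.
- by move=> u; apply: monomial_scale_var.
Qed.

(** * Ideals of Borel type *)

Lemma colon_inf_vars (K : fieldType) n (J : set {mpoly K[n]}) (A : set 'I_n) f :
  is_ideal J ->
  colon_inf J (ideal_span [set 'X_j | j in A]) f <->
  forall j, A j -> exists r, J (f * 'X_j ^+ r).
Proof.
move=> hJ; have [J0 JD JM] := hJ; split=> [[r _ hf] j Aj|hf].
  by exists r; apply: hf; apply: ideal_pow_exp => C [_]; apply; exists j.
have {hf} /choice[r hr] j : exists r, A j -> J (f * 'X_j ^+ r).
  by have [/hf[r]|nAj] := EM (A j); [exists r|exists 0%N].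
have Jf : is_ideal [set g | J (f * g)].
  split=> [|u v|a u] /=; first by rewrite mulr0.
    by rewrite mulrDr; apply: JD.
  by rewrite mulrCA; apply: JM.
(* Pigeonhole: a monomial with more than [\sum_j r j] factors among the variables of [A] contains
   some ['X_j] at least [r j] times. The successor also makes the exponent positive. *)
exists (\sum_j r j).+1 => // g hg; apply: (ideal_msupp Jf); move: g hg.
apply: ideal_pow_sub; first exact: supp_ideal.
move=> F hF _ /msupp_prod[h hh ->] /=; set m := (\sum_i h i)%MM.
suff [j [Aj le_rm]] : exists j, A j /\ (r j <= m j)%N.
  have -> : m = (m - U_(j) *+ r j + U_(j) *+ r j)%MM.
    rewrite submK //; apply/mnm_lepP => l; rewrite mulmnE mnm1E.
    by case: eqP => [<-|_]; rewrite ?mul1n ?mul0n.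
  by rewrite mpolyXD mulrCA -mpolyXn; apply: JM; apply: hr.
have var i : exists2 j, A j & (0 < h i j)%N.
  suff : ideal_span [set 'X_j | j in A] `<=` [set g : {mpoly K[n]} |
    forall m, m \in msupp g -> exists2 j, A j & (0 < m j)%N].
    by move=> /(_ _ (hF i))/(_ _ (hh i)).
  apply: smallest_sub.
    split=> [?|g g' hg hg' ?|a g hg ?] /=; first by rewrite msupp0.
      by move/msuppD_le; rewrite mem_cat => /orP[/hg|/hg'].
    move/msuppM_le/allpairsP => -[[m1 m2] /= [_ /hg[j Aj hj] ->]].
    by exists j => //; rewrite mnmDE addn_gt0 hj orbT.
  move=> _ [j Aj <-] _ /mem_msuppXP <-.
  by exists j; rewrite // mnm1E eqxx.
apply: contrapT => hno.
suff : ((\sum_j r j).+1 <= \sum_j r j)%N by rewrite ltnn.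
(* Double counting: each factor contributes at least one variable of [A] to [m], whereas [hno]
   bounds the exponent of each such ['X_j] by [r j]. *)
rewrite -{1}[(\sum_j r j).+1]card_ord -sum1_card.
apply: (@leq_trans (\sum_i \sum_(j | `[< A j >]) h i j)%N).
  apply: leq_sum => i _; have [j Aj hj] := var i.
  by rewrite (bigD1 j) /=; [rewrite addn_gt0 hj|apply/asboolP].
rewrite exchange_big /= [X in (_ <= X)%N](bigID (fun j => `[< A j >])) /=.
apply: leq_trans (leq_addr _ _); apply: leq_sum => j /asboolP Aj.
rewrite -mnm_sumE -/m leqNgt; apply/negP => /ltnW le_rm.
by apply: hno; exists j.
Qed.

(** Writing the generator ['X_i] as the image of a singleton brings both colon ideals under
    [colon_inf_vars]. *)
Lemma borel_typeP (K : fieldType) n (J : set {mpoly K[n]}) :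
  is_ideal J ->
  borel_type J <->
  forall (i j : 'I_n) f r, (j <= i)%N -> J (f * 'X_i ^+ r) ->
    exists s, J (f * 'X_j ^+ s).
Proof.
move=> hJ; split=> [hB i j f r ji hf|h i]; last first.
  rewrite -(image_set1 (fun j : 'I_n => 'X_j : {mpoly K[n]})).
  apply/seteqP; split=> f /(colon_inf_vars _ _ hJ) hf;
    apply/(colon_inf_vars _ _ hJ) => j /=.
    by have [r hr] := hf i erefl; move=> ji; apply: h ji hr.
  by move=> ->; apply: hf => /=.
have /(colon_inf_vars _ _ hJ) : colon_inf J (ideal_span
    [set 'X_j | j in [set j : 'I_n | (j <= i)%N]]) f; last exact.
rewrite -hB -(image_set1 (fun j : 'I_n => 'X_j : {mpoly K[n]})).
by apply/(colon_inf_vars _ _ hJ) => _ ->; exists r.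
Qed.

Lemma prime_ideal_monomial (K : fieldType) n (P : set {mpoly K[n]}) m :
  is_prime_ideal P -> P 'X_[m] -> exists2 l, (0 < m l)%N & P 'X_l.
Proof.
move=> Pp; have [_ P1 _] := Pp.
rewrite mpolyXE_id => hm; apply: contrapT => hno; move: hm.
apply: (big_ind (fun x => ~ P x)) => // [x y|l _ hl].
  exact: prime_idealNM.
have [e|ml] := posnP (m l); first by rewrite e expr0 in hl.
by apply: hno; exists l => //; apply: prime_idealX hl.
Qed.

(* The exponent depends on [P] only through the set of variables outside [P],
   so finitely many exponents have to be bounded. *)
Lemma Min_nilpotent_uniform (K : fieldType) n (I : set {mpoly K[n]}) j :
  is_monomial_ideal I ->
  exists s, forall P, Min I P -> P 'X_j ->
    exists2 u, ~ P u & I (u * 'X_j ^+ s).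
Proof.
move=> hI; have [idI _] := (monomial_idealP I).1 hI; have [_ _ IM] := idI.
pose vars (P : set {mpoly K[n]}) := [set l : 'I_n | `[< ~ P 'X_l >]]%SET.
have /choice[r hr] A : exists r, forall P, Min I P -> P 'X_j -> vars P = A ->
    exists2 u, ~ P u & I (u * 'X_j ^+ r).
  have [[P0 [hP0 P0j eA]]|hno] :=
      EM (exists P, [/\ Min I P, P 'X_j & vars P = A]); last first.
    by exists 0%N => P hP Pj eA; case: hno; exists P.
  have [u [r [P0u hu]]] := Min_nilpotent idI hP0 P0j.
  have P0p : is_prime_ideal P0 by case: hP0.
  have [P0id _ _] := P0p.
  rewrite mpolyXn in hu.
  (* Whether a prime contains the monomial [w] depends only on the variables in that prime, so [w]
     serves every [P] with the same [vars] as [P0]. *)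
  have [w P0w hw] := monomial_multiplier hI P0id P0u hu.
  exists r => P [Pp _ _] Pj ePA; exists 'X_[w]; last first.
    by rewrite mpolyXn -mpolyXD.
  move=> /(prime_ideal_monomial Pp)[l wl Pl]; apply: P0w.
  have P0l : P0 'X_l.
    have : l \notin vars P by rewrite inE; apply/asboolP; apply.
    by rewrite ePA -eA inE => /asboolP/contrapT.
  have -> : w = (w - U_(l) + U_(l))%MM by rewrite submK // lep1mP -lt0n.
  rewrite mpolyXD.
  by case: P0id => _ _; apply.
exists (\sum_A r A)%N => P hP Pj.
have [u Pu hu] := hr (vars P) P hP Pj erefl.
exists u => //; rewrite (bigD1 (vars P)) //= exprD mulrA mulrC.
exact: IM.
Qed.

Lemma borel_type_symbolic_power (K : fieldType) n (I : set {mpoly K[n]}) k :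
  is_monomial_ideal I -> borel_type I -> borel_type (symbolic_power I k).
Proof.
move=> hI; have [idI _] := (monomial_idealP I).1 hI.
move=> /(borel_typeP idI) hB.
apply/borel_typeP; first exact: symbolic_power_ideal.
move=> i j f r ji hf; have [s hs] := Min_nilpotent_uniform j hI.
have [_ _ IkM] := ideal_pow_ideal I k.
(* One exponent must serve all minimal primes, hence the uniform [s]; the [k]-th power of an element
   [u * 'X_j ^+ s] of [I] lies in the [k]-th power of [I]. *)
exists (s * k)%N => P hP; have [Pp IP _] := hP; apply/loc_kerE.
have [Pj|Pj] := EM (P 'X_j).
  have [u Pu hu] := hs P hP Pj; exists (u ^+ k).
    by move=> /(prime_idealX Pp).
  by rewrite mulrCA exprM -exprMn; apply: IkM; apply: ideal_pow_exp.
(* If ['X_i] were in [P], the Borel property would put in [I], hence in [P], a product of [u] and a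
   power of ['X_j], both outside [P]. *)
have Pi : ~ P 'X_i.
  move=> Pi; have [u [t [Pu hu]]] := Min_nilpotent idI hP Pi.
  have [t' /IP] := hB _ _ _ _ ji hu.
  by apply: prime_idealNM => // /(prime_idealX Pp).
have /loc_kerE[v Pv hv] := hf P hP.
exists (v * 'X_i ^+ r).
  by apply: prime_idealNM => // /(prime_idealX Pp).
by rewrite mulrA mulrC -[v * _ * f]mulrA ['X_i ^+ r * f]mulrC; apply: IkM.
Qed.

Theorem theorem3p8 (K : fieldType) (n : nat) (I : set {mpoly K[n]}) (k : nat)
    (hK : infinite_set [set: K]) (hI : is_monomial_ideal I) (hk : (0 < k)%N) :
  [/\ strongly_stable I ->
        is_monomial_ideal (symbolic_power I k) /\
        strongly_stable (symbolic_power I k),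
      borel_fixed I ->
        is_monomial_ideal (symbolic_power I k) /\
        borel_fixed (symbolic_power I k) &
      borel_type I ->
        is_monomial_ideal (symbolic_power I k) /\
        borel_type (symbolic_power I k)].
Proof.
have hM := symbolic_power_monomial k hK hI.
split=> h; (split; first exact: hM).
- exact: strongly_stable_symbolic_power.
- exact: borel_fixed_symbolic_power.
- exact: borel_type_symbolic_power.
Qed.
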